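(* Let $a,b\in\mathbb{R}$ with $0<|a|<1$, and consider the difference equation $x_{n+1}=\dfrac{x_{n-1}}{a+bx_nx_{n-1}}$, $n\ge 0$, with real initial conditions $(x_{-1},x_0)\in\mathbb{R}^2$. Then every regular solution $\{x_n\}$ converges to a $2$-periodic solution $(p,q)$ of this equation, with $pq=(1-a)/b\neq 0$.
   Context: For $a\neq 1$ and $\alpha=bx_{-1}x_0$, a solution $\{x_n\}_{n\ge-1}$ with initial condition $(x_{-1},x_0)$ is admissible if $\alpha\ne a^n(a-1)/(1-a^n)$ for all integers $n\geq 1$; it is regular if it is admissible, $\alpha\neq 0$ and $\alpha\neq 1-a$. (In particular $b\neq 0$ whenever a regular solution exists.) Convergence to a $2$-periodic solution $(p,q)$ means that $\lim_{k\to\infty}x_{2k+1}=p\in\mathbb{R}$, $\lim_{k\to\infty}x_{2k+2}=q\in\mathbb{R}$, and $p,q,p,q,\dots$ is a solution of the same difference equation (the minimal period may be $1$). *)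

(* Defs.v *)
From Stdlib Require Import Reals.
From Coquelicot Require Import Coquelicot.
Open Scope R_scope.

(* A sequence {x_n}_{n >= -1} is encoded as x : nat -> R shifted by one:
   [x n] stands for x_{n-1}, so the initial condition is (x 0, x 1). *)

(* x_{n+1} = x_{n-1} / (a + b x_n x_{n-1}) for all n >= 0.  Division is total,
   and nonvanishing of the denominators is not built in: for 0 < |a| < 1 it
   is equivalent to [admissible]. *)
Definition is_solution (a b : R) (x : nat -> R) : Prop :=
  forall n : nat, x (S (S n)) = x n / (a + b * x (S n) * x n).

Definition alpha (b : R) (x : nat -> R) : R := b * x 0%nat * x 1%nat.

(* Meant for a with a^n <> 1 for all n >= 1, e.g. 0 < |a| < 1. *)
Definition admissible (a b : R) (x : nat -> R) : Prop :=
  forall n : nat, (1 <= n)%nat -> alpha b x <> a ^ n * (a - 1) / (1 - a ^ n).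

Definition regular (a b : R) (x : nat -> R) : Prop :=
  admissible a b x /\ alpha b x <> 0 /\ alpha b x <> 1 - a.

(* p, q, p, q, ... *)
Definition two_periodic (p q : R) (n : nat) : R :=
  if Nat.even n then p else q.

(* After the index shift, x_{2k+1} is [x (2 * k + 2)] and x_{2k+2} is
   [x (2 * k + 3)]. *)
Definition converges_to_two_periodic_solution
    (a b : R) (x : nat -> R) (p q : R) : Prop :=
  is_lim_seq (fun k : nat => x (2 * k + 2)%nat) (Finite p) /\
  is_lim_seq (fun k : nat => x (2 * k + 3)%nat) (Finite q) /\
  is_solution a b (two_periodic p q).

(* Main.v *)
Require Import Defs.
From Stdlib Require Import Reals Lra Lia.
From Coquelicot Require Import Coquelicot.
Open Scope R_scope.

(** Put t_n = b x_n x_{n+1}, so that t_{n+1} = t_n / (a + t_n).  The reciprocals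
    obey the affine recursion u_{n+1} = a u_n + 1, which gives
    t_n = (1 - a) t_0 / D_n with D_n = t_0 + a^n (1 - a - t_0); admissibility
    says exactly that no D_n vanishes.  Hence x_{n+2} = x_n D_n / D_{n+1}, where
    D_n / D_{n+1} = 1 + O(|a|^n), so the even and odd subsequences converge like
    infinite products.  The product of their limits is
    lim t_n / b = (1 - a) / b. *)

(** Each factor satisfies [Rabs (1 + e k) <= 1 + C * r ^ k <= exp (C * r ^ k)], and these exponents
    sum to at most [C / (1 - r)]. *)
Lemma geometric_perturbation_bounded (y e : nat -> R) (C r : R) :
  0 <= C -> 0 <= r < 1 -> (forall k, y (S k) = y k * (1 + e k)) ->
  (forall k, Rabs (e k) <= C * r ^ k) ->
  forall k, Rabs (y k) <= Rabs (y 0%nat) * exp (C / (1 - r)).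
Proof.
intros hC hr hy he k.
(* The uniform bound does not pass through the induction; the exponent must be the partial geometric
   sum. *)
assert (H : Rabs (y k) <= Rabs (y 0%nat) * exp (C * (1 - r ^ k) / (1 - r))).
{ induction k as [|k IH].
  - replace (C * (1 - r ^ 0) / (1 - r)) with 0 by (simpl; field; lra).
    rewrite exp_0; lra.
  - replace (C * (1 - r ^ S k) / (1 - r))
      with (C * (1 - r ^ k) / (1 - r) + C * r ^ k) by (simpl; field; lra).
    rewrite hy, Rabs_mult, exp_plus, <- Rmult_assoc.
    apply Rmult_le_compat; try apply Rabs_pos; trivial.
    apply Rle_trans with (1 + Rabs (e k)).
    + rewrite <- Rabs_R1 at 2; apply Rabs_triang.
    + apply Rle_trans with (1 + C * r ^ k); [specialize (he k); lra|].
      apply exp_ineq1_le. }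
eapply Rle_trans; [exact H|].
apply Rmult_le_compat_l; [apply Rabs_pos|].
assert (0 <= r ^ k) by (apply pow_le; lra).
assert (Hle : C * (1 - r ^ k) / (1 - r) <= C / (1 - r)).
{ apply Rmult_le_compat_r; [left; apply Rinv_0_lt_compat; lra|nra]. }
destruct Hle as [Hlt|Heq]; [left; apply exp_increasing; exact Hlt|].
rewrite Heq; lra.
Qed.

Lemma ex_finite_lim_seq_of_summable_increments (y : nat -> R) :
  ex_series (fun k => y (S k) - y k) -> ex_finite_lim_seq y.
Proof.
intros [l Hl].
exists (l + y 0%nat).
(* [sum_n] includes the term of index [n], so the telescoped sum plus [y 0] is [y (S n)]. *)
apply is_lim_seq_incr_1.
apply is_lim_seq_ext with
  (fun n => sum_n (fun k => y (S k) - y k) n + y 0%nat).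
- intros n; induction n as [|n IH].
  + rewrite sum_O; ring.
  + rewrite sum_Sn; unfold plus; simpl; lra.
- apply is_lim_seq_plus'; [exact Hl|apply is_lim_seq_const].
Qed.

(** Since [y] is bounded by some [B], its increments [y k * e k] are dominated by the geometric
    series [B * C * r ^ k]. *)
Lemma geometric_perturbation_cv (y e : nat -> R) (C r : R) :
  0 <= C -> 0 <= r < 1 -> (forall k, y (S k) = y k * (1 + e k)) ->
  (forall k, Rabs (e k) <= C * r ^ k) -> ex_finite_lim_seq y.
Proof.
intros hC hr hy he.
pose proof (geometric_perturbation_bounded y e C r hC hr hy he) as hB.
set (B := Rabs (y 0%nat) * exp (C / (1 - r))) in hB.
apply ex_finite_lim_seq_of_summable_increments.
apply (@ex_series_le R_AbsRing R_CompleteNormedModule _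
         (fun k => B * C * r ^ k)).
- intros k; change (Rabs (y (S k) - y k) <= B * C * r ^ k).
  rewrite hy.
  replace (y k * (1 + e k) - y k) with (y k * e k) by ring.
  rewrite Rabs_mult, Rmult_assoc.
  apply Rmult_le_compat; try apply Rabs_pos; auto.
- apply (ex_series_scal_l (B * C) (fun k => r ^ k)), ex_series_geom.
  rewrite Rabs_pos_eq; lra.
Qed.

Definition den (a t : R) (n : nat) : R := t + a ^ n * (1 - a - t).

Lemma Rabs_lt_1_neq_1 (a : R) : Rabs a < 1 -> a <> 1.
Proof. intros h ->; rewrite Rabs_R1 in h; lra. Qed.

Lemma Rabs_pow_lt_1 (a : R) (n : nat) :
  Rabs a < 1 -> (1 <= n)%nat -> Rabs (a ^ n) < 1.
Proof.
intros h hn; rewrite <- RPow_abs.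
apply pow_lt_1_compat; [split; [apply Rabs_pos|exact h]|lia].
Qed.

(** For [n >= 1], solving [den a t n = 0] for [t] gives exactly the value that admissibility
    excludes at [n]. The index 0 is separate: there [den] equals [1 - a]. *)
Lemma den_neq_0 (a b : R) (x : nat -> R) (n : nat) :
  Rabs a < 1 -> admissible a b x -> den a (alpha b x) n <> 0.
Proof.
intros ha hadm h; unfold den in h.
pose proof (Rabs_lt_1_neq_1 a ha).
destruct n as [|n]; [simpl in h; lra|].
assert (hn : (1 <= S n)%nat) by lia.
pose proof (Rabs_lt_1_neq_1 _ (Rabs_pow_lt_1 a _ ha hn)).
apply (hadm _ hn).
apply Rmult_eq_reg_r with (1 - a ^ S n); [|lra].
unfold Rdiv; rewrite Rmult_assoc, Rinv_l by lra; lra.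
Qed.

Lemma is_lim_seq_den (a t : R) : Rabs a < 1 -> is_lim_seq (den a t) t.
Proof.
intros ha; unfold den.
evar_last.
- apply is_lim_seq_plus'; [apply is_lim_seq_const|].
  apply is_lim_seq_mult'; [apply is_lim_seq_geom, ha|apply is_lim_seq_const].
- f_equal; ring.
Qed.

(** The inverses converge to [/ t], and a convergent sequence is bounded. This makes the
    perturbation estimate uniform in [n]. *)
Lemma den_inv_bounded (a t : R) :
  Rabs a < 1 -> t <> 0 -> exists M, forall n, Rabs (/ den a t n) <= M.
Proof.
intros ha ht.
destruct (filterlim_bounded (fun n => / den a t n)) as [M HM].
- exists (/ t); apply (is_lim_seq_inv _ t).
  + apply is_lim_seq_den, ha.
  + intros h; injection h; exact ht.
- exists M; exact HM.
Qed.

Lemma product_formula (a b : R) (x : nat -> R) :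
  Rabs a < 1 -> is_solution a b x -> admissible a b x ->
  alpha b x <> 0 ->
  forall n, b * x (S n) * x n = (1 - a) * alpha b x / den a (alpha b x) n.
Proof.
intros ha hsol hadm ht n.
pose proof (Rabs_lt_1_neq_1 a ha).
induction n as [|n IH].
- unfold den, alpha; simpl; field; lra.
- pose proof (den_neq_0 a b x n ha hadm) as h0.
  pose proof (den_neq_0 a b x (S n) ha hadm) as h1.
  (* This is the affine recursion of the reciprocals, multiplied by [(1 - a) * alpha b x]. *)
  assert (hD : a * den a (alpha b x) n + (1 - a) * alpha b x
               = den a (alpha b x) (S n)) by (unfold den; simpl; ring).
  rewrite hsol.
  replace (b * (x n / (a + b * x (S n) * x n)) * x (S n))
    with (b * x (S n) * x n / (a + b * x (S n) * x n))
    by (unfold Rdiv; ring).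
  rewrite IH.
  set (t := alpha b x) in *.
  rewrite <- hD in h1 |- *.
  field; repeat split; trivial; lra.
Qed.

(** The numerator of the perturbation is the difference of consecutive values of [den], which is a
    multiple of [a ^ n]. *)
Lemma solution_step (a b : R) (x : nat -> R) :
  Rabs a < 1 -> is_solution a b x -> admissible a b x ->
  alpha b x <> 0 ->
  forall n, x (S (S n)) = x n *
    (1 + (1 - a) * (1 - a - alpha b x) * a ^ n * / den a (alpha b x) (S n)).
Proof.
intros ha hsol hadm ht n.
pose proof (den_neq_0 a b x n ha hadm) as h0.
pose proof (den_neq_0 a b x (S n) ha hadm) as h1.
rewrite hsol, (product_formula a b x ha hsol hadm ht).
set (t := alpha b x) in *.
assert (hD : a + (1 - a) * t / den a t n = den a t (S n) / den a t n).
{ apply Rmult_eq_reg_r with (den a t n); [|exact h0].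
  replace ((a + (1 - a) * t / den a t n) * den a t n)
    with (a * den a t n + (1 - a) * t) by (field; exact h0).
  replace (den a t (S n) / den a t n * den a t n)
    with (den a t (S n)) by (field; exact h0).
  unfold den; simpl; ring. }
rewrite hD.
assert (hd : den a t n = den a t (S n) + (1 - a) * (1 - a - t) * a ^ n)
  by (unfold den; simpl; ring).
transitivity (x n * (den a t n / den a t (S n))).
- field; split; assumption.
- rewrite hd at 1; field; assumption.
Qed.

Lemma parity_subsequence_cv (a b : R) (x : nat -> R) (j : nat) :
  Rabs a < 1 -> is_solution a b x -> admissible a b x ->
  alpha b x <> 0 -> ex_finite_lim_seq (fun k => x (2 * k + j)%nat).
Proof.
intros ha hsol hadm ht.
destruct (den_inv_bounded a (alpha b x) ha ht) as [M HM].
set (c := (1 - a) * (1 - a - alpha b x)).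
assert (hM : 0 <= M)
  by (eapply Rle_trans; [apply Rabs_pos|apply (HM 0%nat)]).
(* One step in [k] advances the index by two, so [a ^ (2 * k + j)] splits into ratio [a ^ 2] and
   constant factor [a ^ j]; [M] bounds the inverse of [den]. *)
apply (geometric_perturbation_cv _
  (fun k => c * a ^ (2 * k + j) * / den a (alpha b x) (S (2 * k + j)))
  (Rabs c * Rabs (a ^ j) * M) (Rabs (a ^ 2))).
- repeat apply Rmult_le_pos; trivial; apply Rabs_pos.
- split; [apply Rabs_pos|apply Rabs_pow_lt_1; [exact ha|lia]].
- intros k.
  replace (2 * S k + j)%nat with (S (S (2 * k + j))) by lia.
  apply solution_step; assumption.
- intros k.
  rewrite !Rabs_mult, pow_add, pow_mult, Rabs_mult, RPow_abs.
  replace (Rabs c * Rabs (a ^ j) * M * Rabs ((a ^ 2) ^ k))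
    with (Rabs c * (Rabs ((a ^ 2) ^ k) * Rabs (a ^ j)) * M) by ring.
  apply Rmult_le_compat_l; [|apply HM].
  repeat apply Rmult_le_pos; apply Rabs_pos.
Qed.

(** The hypothesis makes every denominator equal to 1. *)
Lemma is_solution_two_periodic (a b p q : R) :
  b * (p * q) = 1 - a -> is_solution a b (two_periodic p q).
Proof.
intros h n; unfold two_periodic.
rewrite Nat.even_succ_succ, Nat.even_succ, <- Nat.negb_even.
destruct (Nat.even n); simpl.
- replace (a + b * q * p) with 1 by lra; field.
- replace (a + b * p * q) with 1 by lra; field.
Qed.

Theorem theorem3p8 (a b : R) (ha : 0 < Rabs a < 1) (x : nat -> R)
  (hsol : is_solution a b x) (hreg : regular a b x) :
  exists p q : R,
    converges_to_two_periodic_solution a b x p q /\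
    p * q = (1 - a) / b /\ (1 - a) / b <> 0.
Proof.
destruct ha as [_ ha]; destruct hreg as [hadm [ht _]].
pose proof (Rabs_lt_1_neq_1 a ha) as ha1.
assert (hb : b <> 0) by (intros ->; apply ht; unfold alpha; ring).
destruct (parity_subsequence_cv a b x 2 ha hsol hadm ht) as [p hp].
destruct (parity_subsequence_cv a b x 3 ha hsol hadm ht) as [q hq].
(* The limit of one sequence is computed twice: from [p] and [q], and from the product formula,
   where [den] tends to [alpha b x] and cancels it. *)
assert (hpq : b * (p * q) = 1 - a).
{ assert (h1 : is_lim_seq
    (fun k => b * (x (2 * k + 2)%nat * x (2 * k + 3)%nat)) (b * (p * q))).
  { apply is_lim_seq_mult'; [apply is_lim_seq_const|].
    apply is_lim_seq_mult'; assumption. }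
  assert (h2 : is_lim_seq
    (fun k => b * (x (2 * k + 2)%nat * x (2 * k + 3)%nat)) (1 - a)).
  { apply is_lim_seq_ext with
      (fun k => (1 - a) * alpha b x / den a (alpha b x) (2 * k + 2)).
    - intros k; rewrite <- (product_formula a b x ha hsol hadm ht).
      replace (2 * k + 3)%nat with (S (2 * k + 2)) by lia; ring.
    - evar_last.
      + apply is_lim_seq_div'; [apply is_lim_seq_const| |exact ht].
        apply (is_lim_seq_subseq (den a (alpha b x)) _
                 (fun k => (2 * k + 2)%nat)).
        * apply eventually_subseq; intros k; lia.
        * apply is_lim_seq_den, ha.
      + f_equal; field; exact ht. }
  apply is_lim_seq_unique in h1; apply is_lim_seq_unique in h2.
  rewrite h1 in h2; injection h2; trivial. }
exists p, q; split; [|split].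
- split; [exact hp|split; [exact hq|]].
  apply is_solution_two_periodic, hpq.
- rewrite <- hpq; field; exact hb.
- intros h; apply ha1.
  apply Rmult_eq_compat_r with (r := b) in h.
  unfold Rdiv in h; rewrite Rmult_assoc, Rinv_l in h by exact hb; lra.
Qed.
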